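(* Let $G=(V,E)$ be a connected finite graph with symmetric positive edge weights $\omega_{xy}=\omega_{yx}>0$ ($xy\in E$) and a measure $\mu:V\to(0,\infty)$. Let $M\ge1$ be an integer and let $p_1,\dots,p_M\in V$ be distinct vertices. For $\lambda>0$ consider the equation $$\Delta u=-\lambda\, e^{F(u)}\left[e^{F(u)}-1\right]^2+4\pi\sum_{j=1}^{M}\delta_{p_j}\quad\text{on } V, \qquad (\ast)_\lambda$$ and let $\lambda_c>0$ be its critical value, i.e. $(\ast)_\lambda$ has a solution if and only if $\lambda\ge\lambda_c$. Let $(\tilde u_\lambda)_{\lambda\ge\lambda_c}$ be a family such that $\tilde u_\lambda$ is a solution of $(\ast)_\lambda$ for each $\lambda\ge\lambda_c$ and $\tilde u_{\lambda_1}\ge\tilde u_{\lambda_2}$ on $V$ whenever $\lambda_1>\lambda_2$. Let $u_0:V\to\mathbb{R}$ be a solution of $$\Delta u_0=-\frac{4\pi M}{|V|}+4\pi\sum_{j=1}^M\delta_{p_j}$$ and put $\tilde v_\lambda=\tilde u_\lambda-u_0$. Then for almost every $\lambda>\lambda_c$ (with respect to Lebesgue measure), $\tilde v_\lambda$ is a strict local minimum on $W^{1,2}(V)$ of the functional $$J_\lambda(v)=\frac12\int_V|\nabla v|^2\,d\mu+\frac{\lambda}{4}\int_V\left[e^{F(u_0+v)}-1\right]^4d\mu+\frac{4\pi M}{|V|}\int_V v\,d\mu .$$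
   Context: The graph Laplacian acts on $u:V\to\mathbb{R}$ by $\Delta u(x)=\frac{1}{\mu(x)}\sum_{y\sim x}\omega_{yx}[u(y)-u(x)]$, where $y\sim x$ means $xy\in E$. Integrals are $\int_V f\,d\mu=\sum_{x\in V}\mu(x)f(x)$, and $|\nabla v|^2(x)=\frac{1}{2\mu(x)}\sum_{y\sim x}\omega_{xy}[v(y)-v(x)]^2$. $W^{1,2}(V)$ is the (finite-dimensional) space of all functions $V\to\mathbb{R}$ with norm $\|u\|_{W^{1,2}(V)}=\left(\int_V(|\nabla u|^2+u^2)\,d\mu\right)^{1/2}$. The function $F:\mathbb{R}\to(-\infty,0]$ is defined by $F(u)=\widetilde F(u)$ for $u\le0$ and $F(u)=0$ for $u>0$, where for $u\le0$, $\widetilde F(u)$ is the unique $t\le0$ with $u=1+t-e^t$. $\delta_p$ is the Dirac delta mass at the vertex $p$ with respect to $\mu$: $\delta_p(p)=1/\mu(p)$ and $\delta_p(x)=0$ for $x\neq p$. $|V|=\sum_{x\in V}\mu(x)$ is the total measure of $V$. It is known that such a critical value $\lambda_c$ and such a monotone family $(\tilde u_\lambda)_{\lambda\ge\lambda_c}$ exist. Critical points of $J_\lambda$ are exactly the solutions $v$ of $\Delta v=-\lambda e^{F(u_0+v)}[e^{F(u_0+v)}-1]^2+\frac{4\pi M}{|V|}$, the equation obtained from $(\ast)_\lambda$ by substituting $u=u_0+v$. *)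

(* Defs.v *)
From HB Require Import structures.
From mathcomp Require Import all_boot all_order all_algebra.
From mathcomp Require Import all_classical all_reals all_analysis.
From mathcomp Require Import lra.

Set Implicit Arguments.
Unset Strict Implicit.
Unset Printing Implicit Defensive.

Import Order.TTheory GRing.Theory Num.Theory.
Import numFieldNormedType.Exports.
Local Open Scope classical_set_scope.
Local Open Scope ring_scope.

(* [weight] is constrained only on edges, and every sum below runs over edges
   only.  Loops are not excluded, but they contribute nothing to the Laplacian
   or to the gradient. *)
Record weighted_graph (R : realType) (V : finType) := WeightedGraph {
  adj : rel V;
  weight : V -> V -> R;
  vmeas : V -> R;
  adj_sym : symmetric adj;
  weight_sym : forall x y, adj x y -> weight x y = weight y x;
  weight_gt0 : forall x y, adj x y -> 0 < weight x y;
  vmeas_gt0 : forall x, 0 < vmeas x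
}.

Definition connected_graph (R : realType) (V : finType)
    (G : weighted_graph R V) : Prop :=
  forall x y : V, connect (adj G) x y.

Definition vint (R : realType) (V : finType) (G : weighted_graph R V)
    (f : V -> R) : R :=
  \sum_(x : V) vmeas G x * f x.

Definition volume (R : realType) (V : finType) (G : weighted_graph R V) : R :=
  \sum_(x : V) vmeas G x.

Definition laplacian (R : realType) (V : finType) (G : weighted_graph R V)
    (u : V -> R) (x : V) : R :=
  (vmeas G x)^-1 * \sum_(y | adj G x y) weight G y x * (u y - u x).

Definition grad_sq (R : realType) (V : finType) (G : weighted_graph R V)
    (v : V -> R) (x : V) : R :=
  (2 * vmeas G x)^-1 * \sum_(y | adj G x y) weight G x y * (v y - v x) ^+ 2.

Definition W12norm (R : realType) (V : finType) (G : weighted_graph R V)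
    (u : V -> R) : R :=
  Num.sqrt (vint G (fun x => grad_sq G u x + u x ^+ 2)).

Definition vdirac (R : realType) (V : finType) (G : weighted_graph R V)
    (p x : V) : R :=
  if x == p then (vmeas G p)^-1 else 0.

(* Only meaningful for [u <= 0]; see [FtildeP] and [Ftilde_unique]. *)
Definition Ftilde (R : realType) (u : R) : R :=
  xget 0 [set t : R | t <= 0 /\ u = 1 + t - expR t].

Definition F (R : realType) (u : R) : R := if u <= 0 then Ftilde u else 0.

Lemma FtildeP (R : realType) (u : R) : u <= 0 ->
  Ftilde u <= 0 /\ u = 1 + Ftilde u - expR (Ftilde u).
Proof.
move=> u0; rewrite /Ftilde; case: xgetP => [t _ //|noroot]; exfalso.
pose g (t : R) := 1 + t - expR t.
have gc : {within `[u - 1, 0], continuous g}.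
  apply: continuous_subspaceT => t.
  apply: cvgB; last exact: continuous_expR.
  by apply: cvgD; [exact: cvg_cst|exact: cvg_id].
have [||t] := @IVT R g (u - 1) 0 u _ gc; first by lra.
  have gl : g (u - 1) <= u by rewrite /g; have := expR_ge0 (u - 1); lra.
  have gr : g 0 = 0 by rewrite /g expR0; lra.
  by rewrite gr ge_min gl le_max u0 orbT.
rewrite in_itv /= => /andP[_ t0] gt.
by apply: (noroot t); split=> //; rewrite -gt.
Qed.

Lemma Ftilde_unique (R : realType) (u t : R) :
  t <= 0 -> u = 1 + t - expR t -> Ftilde u = t.
Proof.
have inc (a b : R) : b <= 0 -> a < b -> 1 + a - expR a < 1 + b - expR b.
  move=> b0 ab.
  have ab0 : a - b != 0 by rewrite subr_eq0 lt_eqF.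
  have h1 : 1 + (a - b) < expR (a - b) by exact: expR_gt1Dx.
  have h2 : expR (a - b) < 1 by rewrite expR_lt1 subr_lt0.
  have h3 : expR b <= 1 by rewrite -expR0 ler_expR.
  have h4 : expR a = expR b * expR (a - b) by rewrite -expRD addrC subrK.
  rewrite h4; have := expR_gt0 b; nra.
move=> t0 ut; rewrite /Ftilde; case: xgetP => [s _ [s0 us]|/(_ t)]; last first.
  by case; split.
have [st|ts|//] := ltgtP s t.
- by have := inc _ _ t0 st; rewrite -us -ut ltxx.
- by have := inc _ _ s0 ts; rewrite -us -ut ltxx.
Qed.

Definition vortex_eq (R : realType) (V : finType) (G : weighted_graph R V)
    (M : nat) (p : 'I_M -> V) (lambda : R) (u : V -> R) : Prop :=
  forall x : V,
    laplacian G u x =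
      - lambda * expR (F (u x)) * (expR (F (u x)) - 1) ^+ 2
      + 4 * pi * \sum_(j < M) vdirac G (p j) x.

Definition critical_value (R : realType) (V : finType)
    (G : weighted_graph R V) (M : nat) (p : 'I_M -> V) (lambda_c : R) : Prop :=
  0 < lambda_c /\
  forall lambda : R, 0 < lambda ->
    ((exists u : V -> R, vortex_eq G p lambda u) <-> lambda_c <= lambda).

Definition background_eq (R : realType) (V : finType)
    (G : weighted_graph R V) (M : nat) (p : 'I_M -> V) (u0 : V -> R) : Prop :=
  forall x : V,
    laplacian G u0 x =
      - (4 * pi * M%:R / volume G)
      + 4 * pi * \sum_(j < M) vdirac G (p j) x.

Definition J (R : realType) (V : finType) (G : weighted_graph R V) (M : nat)
    (u0 : V -> R) (lambda : R) (v : V -> R) : R :=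
  2^-1 * vint G (grad_sq G v)
  + lambda / 4 * vint G (fun x => (expR (F (u0 x + v x)) - 1) ^+ 4)
  + 4 * pi * M%:R / volume G * vint G v.

Definition strict_local_min_W12 (R : realType) (V : finType)
    (G : weighted_graph R V) (Phi : (V -> R) -> R) (v0 : V -> R) : Prop :=
  exists2 eps : R, 0 < eps &
    forall v : V -> R, v <> v0 -> W12norm G (v \- v0) < eps -> Phi v0 < Phi v.

(* Main.v *)
(* Write f(u) = e^F(u) (e^F(u) - 1)^2, so that ((e^F - 1)^4 / 4)' = - f.
   Solutions are negative by the maximum principle, and F is smooth on the
   negative half-line.  Since sum_x u_lambda(x) is nondecreasing in lambda, for
   almost every lambda its difference quotients do not tend to infinity, so
   those of u_lambda stay bounded along some lambda' -> lambda.  For lambda'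
   close enough to lambda, w = (u_lambda' - u_lambda) / (lambda' - lambda) >= 0
   satisfies - Laplacian w - lambda f'(u_lambda) w > 0; hence w > 0, and
   Picone's identity for w shows that the second variation of J_lambda at
   u_lambda - u_0 is positive definite.  No limit of the quotients is needed. *)
Require Import Defs.
From HB Require Import structures.
From mathcomp Require Import all_boot all_order all_algebra.
From mathcomp Require Import all_classical all_reals all_analysis.
From mathcomp Require Import ring lra.

Set Implicit Arguments.
Unset Strict Implicit.
Unset Printing Implicit Defensive.

Import Order.TTheory GRing.Theory Num.Theory.
Import numFieldNormedType.Exports.
Local Open Scope classical_set_scope.
Local Open Scope ring_scope.

(** * The nonlinearity on the negative half-line *)

Lemma F_le0 (R : realType) (u : R) : F u <= 0.
Proof. by rewrite /F; case: ifP => // /FtildeP[]. Qed.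

Lemma F_lt0 (R : realType) (u : R) : u < 0 -> F u < 0.
Proof.
move=> u0; rewrite lt_neqAle F_le0 andbT; apply/eqP => Fu0.
have [_] := FtildeP (ltW u0).
move: Fu0; rewrite /F (ltW u0) => ->.
by rewrite expR0 addr0 subrr => u00; rewrite u00 ltxx in u0.
Qed.

Lemma F_inv (R : realType) (t : R) : t <= 0 -> F (1 + t - expR t) = t.
Proof.
move=> t0; rewrite /F ifT; first exact: Ftilde_unique.
by have := expR_ge1Dx t; lra.
Qed.

(** [F] locally inverts t -> 1 + t - e^t, whose derivative 1 - e^t does not vanish for t < 0. The
    slope of [F] blows up as [u] tends to 0 from below. *)
Lemma is_derive_F (R : realType) (u : R) :
  u < 0 -> is_derive u 1 (@F R) (1 - expR (F u))^-1.
Proof.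
move=> u0; have t0 := F_lt0 u0.
pose g (t : R) := 1 + t - expR t.
have gu : g (F u) = u.
  by rewrite /g; have [_ ] := FtildeP (ltW u0); rewrite /F (ltW u0).
rewrite -[X in is_derive X]gu.
apply: is_derive_inverse.
- near=> t; apply: F_inv; apply: ltW; near: t.
  exact: lt_nbhsl.
- near=> t; apply: cvgB; last exact: continuous_expR.
  by apply: cvgD; [exact: cvg_cst|exact: cvg_id].
- by apply: is_derive_eq; rewrite add0r.
- by rewrite gt_eqF// subr_gt0 expR_lt1.
Unshelve. all: by end_near. Qed.

Definition vortex_term (R : realType) (u : R) : R :=
  expR (F u) * (expR (F u) - 1) ^+ 2.

(** The derivative of [vortex_term]: with s = e^F and F' = 1/(1 - s), the s-derivative (1 - s)(1 -
    3s) of s(s - 1)^2 cancels the singular factor of s' = s/(1 - s). *)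
Definition dvortex_term (R : realType) (u : R) : R :=
  expR (F u) - 3 * expR (F u) ^+ 2.

Lemma vortex_term_gt0 (R : realType) (u : R) : u < 0 -> 0 < vortex_term u.
Proof.
move=> /F_lt0 t0; rewrite mulr_gt0 ?expR_gt0// exprn_even_gt0//=.
by rewrite subr_eq0 lt_eqF// expR_lt1.
Qed.

Lemma is_derive_vortex_term (R : realType) (u : R) :
  u < 0 -> is_derive u 1 (@vortex_term R) (dvortex_term u).
Proof.
move=> u0; have dF := is_derive_F u0.
have d1 : is_derive u 1 (fun x => expR (F x)) (expR (F u) * (1 - expR (F u))^-1).
  exact: is_derive1_comp.
have : is_derive u 1 ((fun x => expR (F x)) * ((fun x => expR (F x)) - cst 1) ^+ 2)
   (dvortex_term u).
  apply: is_derive_eq.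
  rewrite /= !fctE /dvortex_term /= /GRing.scale/=.
  have : 1 - expR (F u) != 0 by rewrite gt_eqF// subr_gt0 expR_lt1 F_lt0.
  by move=> ?; field.
by [].
Qed.

Lemma is_derive_potential (R : realType) (u : R) :
  u < 0 -> is_derive u 1 (fun u : R => (expR (F u) - 1) ^+ 4)
             (- 4 * vortex_term u).
Proof.
move=> u0; have dF := is_derive_F u0.
have d1 : is_derive u 1 (fun x => expR (F x)) (expR (F u) * (1 - expR (F u))^-1).
  exact: is_derive1_comp.
have : is_derive u 1 (((fun x => expR (F x)) - cst 1) ^+ 4)
   (- 4 * vortex_term u).
  apply: is_derive_eq.
  rewrite /= !fctE /vortex_term /= /GRing.scale/=.
  have : 1 - expR (F u) != 0 by rewrite gt_eqF// subr_gt0 expR_lt1 F_lt0.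
  by move=> ?; field.
by [].
Qed.

(** * Second-order Taylor expansion of the potential *)

Lemma is_derive_near (R : realType) (f : R -> R) (u d e : R) :
  is_derive u 1 f d -> 0 < e ->
  \forall h \near (0 : R), `|f (u + h) - f u - d * h| <= e * `|h|.
Proof.
move=> [fu <-] e0; have /derivable_nbhs/eqaddoP/(_ e e0) := fu.
apply: filterS => h /=.
by rewrite !fctE /= /GRing.scale/= mulr1 opprD addrA (addrC h) (mulrC h).
Qed.

(** Mean value theorem for the remainder [k] between 0 and [h]: its derivative is the first-order
    remainder of [f] at [u], which is at most e|h| there. *)
Lemma taylor2_near (R : realType) (g f : R -> R) (u d e : R) :
  (\forall x \near (u : R), is_derive (x : R) 1 g (f x)) -> is_derive u 1 f d -> 0 < e ->
  \forall h \near (0 : R),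
    `|g (u + h) - g u - f u * h - d / 2 * h ^+ 2| <= e * h ^+ 2.
Proof.
move=> /nbhs_ballP[r /= r0 rg] df e0.
have /nbhs_ballP[s /= s0 sf] := is_derive_near df e0.
apply/nbhs_ballP; exists (Num.min r s) => /=; first by rewrite lt_min r0.
move=> h; rewrite /ball/= sub0r normrN lt_min => /andP[hr hs].
pose k (x : R) := g (u + x) - f u * x - d / 2 * x ^+ 2.
have dk (x : R) : `|x| <= `|h| -> is_derive x 1 k (f (u + x) - f u - d * x).
  move=> xh.
  have dg : is_derive (u + x) 1 g (f (u + x)).
    by apply: rg; rewrite /ball/= opprD addrA subrr sub0r normrN (le_lt_trans xh).
  have dgx : is_derive x 1 (g \o (fun x => u + x)) (f (u + x)).
    have dux : is_derive x 1 (cst u + id) 1.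
      by apply: is_derive_eq; rewrite add0r.
    by have := is_derive1_comp dg dux; rewrite mulr1.
  have : is_derive x 1 (g \o (fun x => u + x) - (cst (f u) * id)
      - (cst (d / 2) * id ^+ 2)) (f (u + x) - f u - d * x).
    by apply: is_derive_eq; rewrite /= !fctE/= /GRing.scale/=; field.
  by [].
have [c ch kc] : exists2 c, `|c| <= `|h| & k h - k 0 = (f (u + c) - f u - d * c) * h.
  have [h0|h0] := leP 0 h.
    have inh x : x \in `[0, h] -> `|x| <= `|h|.
      by rewrite in_itv/= => /andP[x0 xh]; rewrite !ger0_norm// (le_trans x0).
    have [x xh||c /inh ch ->] :=
        @MVT_segment R k (fun x => f (u + x) - f u - d * x) 0 h h0.
    - by apply: dk; apply: inh; exact: subset_itv_oo_cc.
    - apply: derivable_within_continuous => x /inh /dk dkx.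
      exact: ex_derive.
    - by exists c => //; rewrite subr0.
  have inh x : x \in `[h, 0] -> `|x| <= `|h|.
    by rewrite in_itv/= => /andP[x0 xh]; rewrite !ler0_norm ?lerN2// ltW.
  have [x xh||c /inh ch kc] :=
      @MVT_segment R k (fun x => f (u + x) - f u - d * x) h 0 (ltW h0).
  - by apply: dk; apply: inh; exact: subset_itv_oo_cc.
  - apply: derivable_within_continuous => x /inh /dk dkx.
    exact: ex_derive.
  - by exists c => //; rewrite -opprB kc sub0r mulrN opprK.
have -> : g (u + h) - g u - f u * h - d / 2 * h ^+ 2 = k h - k 0.
  by rewrite /k addr0 mulr0 expr0n/= mulr0; ring.
rewrite kc normrM -[h ^+ 2]real_normK ?num_real// expr2 mulrA ler_wpM2r//.
apply: (le_trans (sf c _)); last by rewrite ler_wpM2l// ltW.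
by rewrite /ball/= sub0r normrN (le_lt_trans ch).
Qed.

Lemma potential_taylor2 (R : realType) (u e : R) : u < 0 -> 0 < e ->
  \forall h \near (0 : R),
    `|(expR (F (u + h)) - 1) ^+ 4 - (expR (F u) - 1) ^+ 4
      - - 4 * vortex_term u * h - - 4 * dvortex_term u / 2 * h ^+ 2|
    <= e * h ^+ 2.
Proof.
move=> u0 e0.
pose pot (x : R) := (expR (F x) - 1) ^+ 4.
pose dpot (x : R) := - 4 * vortex_term x.
have d2 : is_derive u 1 dpot (- 4 * dvortex_term u).
  have df := is_derive_vortex_term u0.
  have : is_derive u 1 (cst (- 4) * @vortex_term R) (- 4 * dvortex_term u).
    by apply: is_derive_eq; rewrite /GRing.scale/= mulr0 addr0.
  by [].
have d1 : \forall x \near (u : R), is_derive (x : R) 1 pot (dpot x).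
  by near=> x; apply: is_derive_potential; near: x; exact: lt_nbhsl.
exact: (taylor2_near d1 d2 e0).
Unshelve. all: by end_near. Qed.

(** * Difference quotients of monotone functions *)

(** The tail intersections [D n] of the covers increase with n and still contain [E n], because [E]
    is nondecreasing; continuity from below then bounds the measure of their union. The sets [E n]
    themselves may be non-measurable. *)
Lemma bigcup_cover_le d (T : measurableType d) (R : realType)
    (mu : {measure set T -> \bar R}) (E : (set T)^nat) (c : \bar R) :
  nondecreasing_seq E ->
  (forall n, exists A, [/\ measurable A, E n `<=` A & (mu A <= c)%E]) ->
  exists A, [/\ measurable A, \bigcup_n E n `<=` A & (mu A <= c)%E].
Proof.
move=> ndE /choice[A EA].
pose D n := \bigcap_k A (n + k)%N.
have mD n : measurable (D n) by apply: bigcapT_measurable => k; case: (EA (n + k)%N).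
have DA n : D n `<=` A n by move=> x /(_ 0%N); rewrite addn0; exact.
have ndD : nondecreasing_seq D.
  move=> n m nm; apply/subsetPset => x Dx k _.
  by have := Dx (m - n + k)%N; rewrite addnA subnKC//; exact.
exists (\bigcup_n D n); split.
- exact: bigcupT_measurable.
- move=> x [n _ Enx]; exists n => // k _.
  case: (EA (n + k)%N) => _ + _; apply.
  by have /subsetPset := ndE _ _ (leq_addr k n); exact.
- have cv := nondecreasing_cvg_mu (mu := mu) mD (bigcupT_measurable _ mD) ndD.
  rewrite -(cvg_lim _ cv)//; apply: lime_le; first by apply/cvg_ex; eexists; exact: cv.
  apply: nearW => n /=; case: (EA n) => mA _; apply: le_trans.
  by apply: le_measure; rewrite ?inE//.
Qed.

(* On a piece shorter than [d], any two points of the set are at distance at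
   most the increment of [S] over the piece divided by [K]. *)
Lemma steep_cover (R : realType) (S : R -> R) (a b K d : R) :
  {homo S : x y / x <= y} -> a < b -> 0 < K -> 0 < d ->
  exists A : set R, [/\ measurable A,
    [set x | a <= x < b /\ forall y, `|y - x| < d ->
       K * `|y - x| <= `|S y - S x|] `<=` A &
    (lebesgue_measure A <= ((S b - S a) / K *+ 2)%:E)%E].
Proof.
move=> ndS ab K0 d0; set E := [set x | _].
have ba0 : 0 < b - a by rewrite subr_gt0.
(* The successor makes the piece length [h] strictly smaller than [d]. *)
pose N := (Num.truncn ((b - a) / d)).+1.
pose h := (b - a) / N%:R.
have h0 : 0 < h by rewrite divr_gt0.
have hd : h < d.
  rewrite ltr_pdivrMr// mulrC -ltr_pdivrMr//.
  by have /truncn_itv/andP[] : 0 <= (b - a) / d by rewrite divr_ge0 ?ltW.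
pose c (k : nat) := a + h * k%:R.
have c0 : c 0%N = a by rewrite /c mulr0 addr0.
have cN : c N = b by rewrite /c /h divfK ?pnatr_eq0// addrC subrK.
have cS k : c k <= c k.+1 by rewrite lerD2l ler_wpM2l ?ler_nat// ltW.
pose r k := (S (c k.+1) - S (c k)) / K.
have r0 k : 0 <= r k by rewrite divr_ge0 ?subr_ge0 ?ndS// ltW.
pose P k := E `&` [set x | c k <= x < c k.+1].
pose z k := xget 0 (P k).
pose A k : set R := `[z k - r k, z k + r k]%classic.
exists (\big[setU/set0]_(k < N) A k); split.
- by apply: bigsetU_measurable => k _; exact: measurable_itv.
- move=> x Ex; have [/andP[ax xb] _] := Ex.
  pose k := Num.truncn ((x - a) / h).
  have xa0 : 0 <= (x - a) / h by rewrite divr_ge0 ?subr_ge0// ltW.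
  have /andP[kx xk] := truncn_itv xa0.
  have kN : (k < N)%N.
    rewrite truncn_lt_nat// ltr_pdivrMr// mulrC /h divfK ?pnatr_eq0//.
    by rewrite ltrD2r.
  have Px : P k x.
    split=> //=; apply/andP; split.
      by move: kx; rewrite -/k ler_pdivlMr// /c (mulrC h); lra.
    by move: xk; rewrite -/k ltr_pdivrMr// /c (mulrC h); lra.
  rewrite -bigcup_mkord; exists k => //=.
  have [Ez zk] : P k (z k) by apply: (xgetPex 0); exists x.
  have [_ {}Ez] := Ez.
  have /andP[zk1 zk2] : c k <= z k < c k.+1 by [].
  have ck1 : c k.+1 - c k = h by rewrite /c -natr1; ring.
  have /andP[xk1 xk2] : c k <= x < c k.+1 by case: Px.
  have xzd : `|x - z k| < d.
    by apply: le_lt_trans hd; rewrite ler_norml; lra.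
  have Sxz : `|S x - S (z k)| <= S (c k.+1) - S (c k).
    have := ndS (c k) x; have := ndS x (c k.+1).
    have := ndS (c k) (z k); have := ndS (z k) (c k.+1).
    rewrite zk1 xk1 (ltW zk2) (ltW xk2).
    move=> /(_ isT) ? /(_ isT) ? /(_ isT) ? /(_ isT) ?.
    by rewrite ler_norml; lra.
  have : `|x - z k| <= r k.
    by rewrite ler_pdivlMr// mulrC (le_trans (Ez _ xzd)).
  by rewrite /A /= in_itv/= ler_norml; lra.
(* By subadditivity it suffices to add up the lengths 2 [r k], and the increments of [S]
   telescope. *)
- apply: (@le_trans _ _ (\sum_(k < N) lebesgue_measure (A k))%E).
    apply: content_subadditive => //; first by move=> k _; exact: measurable_itv.
    by apply: bigsetU_measurable => k _; exact: measurable_itv.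
  have mA k : lebesgue_measure (A k) = (r k *+ 2)%:E.
    rewrite lebesgue_measure_itv/= lte_fin; case: ifPn => [_|].
      by rewrite -EFinD; congr EFin; rewrite mulr2n; lra.
    by rewrite -leNgt => rk; congr EFin; rewrite mulr2n; have := r0 k; lra.
  under eq_bigr do rewrite mA.
  rewrite sumEFin lee_fin sumrMnl /r -mulr_suml.
  by rewrite -(big_mkord xpredT (fun k => S (c k.+1) - S (c k))) telescope_sumr// c0 cN.
Qed.

(* A weak form of Lebesgue's theorem on the differentiability of monotone
   functions: almost everywhere the difference quotient does not tend to
   infinity. *)
Lemma ae_bounded_slope (R : realType) (S : R -> R) :
  {homo S : x y / x <= y} ->
  {ae @lebesgue_measure R, forall x : R, exists K : R, forall d, 0 < d ->
     exists y, [/\ `|y - x| < d, y != x & `|S y - S x| <= K * `|y - x|]}.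
Proof.
move=> ndS.
(* Exceptional points are sorted by location ([N]), slope ([K]) and radius of validity ([n]); for
   fixed [K] and [N] the sets grow with [n]. *)
pose E (K : R) (N n : nat) : set R := [set x | - N.+1%:R <= x < N.+1%:R /\
  forall y, `|y - x| < n.+1%:R^-1 -> K * `|y - x| <= `|S y - S x|].
pose B (N : nat) : set R := \bigcap_k \bigcup_n E k.+1%:R N n.
suff nB : (@lebesgue_measure R).-negligible (\bigcup_N B N).
  apply: negligibleS nB.
  move=> x /= bx.
  exists (Num.truncn `|x|) => // k _.
  have := (forallNP _).2 bx k.+1%:R => /existsNP[d /not_implyP[d0 /forallNP xd]].
  exists (Num.truncn d^-1) => //; split.
    have := truncnS_gt `|x|.
    by rewrite ltr_norml => /andP[/ltW -> ->].
  move=> y yx; have [->|yNx] := eqVneq y x; first by rewrite !subrr !normr0 mulr0.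
  rewrite leNgt; apply/negP => yk; apply: (xd y); split=> //; last exact: ltW.
  apply: (lt_le_trans yx); rewrite -[leRHS]invrK lef_pV2 ?posrE ?invr_gt0//.
  exact/ltW/truncnS_gt.
apply: negligible_bigcup => N.
have /choice[A EA] k : exists A : set R, [/\ measurable A,
    \bigcup_n E k.+1%:R N n `<=` A &
    (lebesgue_measure A <= ((S N.+1%:R - S (- N.+1%:R)) / k.+1%:R *+ 2)%:E)%E].
  apply: (@bigcup_cover_le _ _ R (@lebesgue_measure R)) => [n m nm|n]; last first.
    by apply: steep_cover => //; exact: gtrN.
  apply/subsetPset => x [xN Ex]; split=> // y yx; apply: Ex.
  by apply: (lt_le_trans yx); rewrite lef_pV2 ?posrE// ler_nat.
exists (\bigcap_k A k); split.
- by apply: bigcapT_measurable => k; case: (EA k).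
- apply/eqP; rewrite -measure_le0; apply/lee_addgt0Pr => e e0; rewrite add0e.
  pose c := (S N.+1%:R - S (- N.+1%:R)) *+ 2.
  have c0 : 0 <= c.
    by rewrite mulrn_wge0// subr_ge0 ndS// ltW// gtrN.
  (* The cover for slope k + 1 has measure at most c/(k + 1), which is below [e] for this k. *)
  pose k := Num.truncn (c / e).
  case: (EA k) => mA _ Ak.
  apply: (@le_trans _ _ (lebesgue_measure (A k))).
    apply: le_measure; rewrite ?inE//; last by move=> x; exact.
    by apply: bigcapT_measurable => j; case: (EA j).
  apply: (le_trans Ak); rewrite lee_fin -mulrnAl -/c ler_pdivrMr// mulrC.
  by rewrite -ler_pdivrMr// ltW// truncnS_gt.
- by move=> x Bx k _; case: (EA k) => _ + _; apply; exact: Bx.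
Qed.

(** * Calculus on the graph *)

Lemma near0_forall (R : realType) (I : finType) (P : I -> R -> Prop) :
  (forall i, \forall h \near (0 : R), P i h) ->
  exists2 r, 0 < r & forall h, `|h| < r -> forall i, P i h.
Proof.
move=> nP.
have /nbhs_ballP[r /= r0 rP] : \forall h \near (0 : R), forall i, P i h.
  exact: (@filter_forall R I P _ _ nP).
exists r => // h hr; apply: rP.
by rewrite /ball/= sub0r normrN.
Qed.

Lemma pos_lower_bound (R : realType) (I : finType) (f : I -> R) :
  (forall i, 0 < f i) -> exists2 m, 0 < m & forall i, m <= f i.
Proof.
move=> f0.
have : \forall m \near (0:R)^'+, 0 < m /\ forall i, m <= f i.
  near=> m; split; first by near: m; exact: nbhs_right_gt.
  by near: m; apply: filter_forall => i; exact: nbhs_right_le.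
by move=> /filter_ex[m [m0 mf]]; exists m.
Unshelve. all: by end_near. Qed.

(** Exchanging the indices, with [a] symmetric, gives a second expression [L'] of the sum; averaging
    the two yields the factor 1/2. *)
Lemma sum_by_parts (R : realType) (V : finType) (a : V -> V -> R)
    (u h : V -> R) :
  (forall x y, a x y = a y x) ->
  \sum_x (\sum_y a x y * (u y - u x)) * h x =
  - 2^-1 * \sum_x \sum_y a x y * ((u y - u x) * (h y - h x)).
Proof.
move=> a_sym; set L := LHS.
pose L' := \sum_x \sum_y a x y * (u x - u y) * h y.
have LE : L = \sum_x \sum_y a x y * (u y - u x) * h x.
  by apply: eq_bigr => x _; rewrite mulr_suml.
have LL' : L = L'.
  rewrite LE exchange_big; apply: eq_bigr => x _; apply: eq_bigr => y _.
  by rewrite a_sym.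
have : L + L' = - \sum_x \sum_y a x y * ((u y - u x) * (h y - h x)).
  rewrite LE -big_split -sumrN; apply: eq_bigr => x _ /=.
  rewrite -big_split -sumrN; apply: eq_bigr => y _ /=; ring.
by rewrite -LL'; lra.
Qed.

(** Summing by parts against h^2/w, the two sides differ on each edge by the square (w_x h_y - w_y
    h_x)^2 / (w_x w_y), up to a nonnegative factor. *)
Lemma picone (R : realType) (V : finType) (a : V -> V -> R) (w h : V -> R) :
  (forall x y, a x y = a y x) -> (forall x y, 0 <= a x y) ->
  (forall x, 0 < w x) ->
  - \sum_x (\sum_y a x y * (w y - w x)) * (h x ^+ 2 / w x) <=
  2^-1 * \sum_x \sum_y a x y * (h y - h x) ^+ 2.
Proof.
move=> a_sym a_ge0 w_gt0; rewrite sum_by_parts// mulNr opprK ler_wpM2l//.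
apply: ler_sum => x _; apply: ler_sum => y _; rewrite ler_wpM2l//.
have wx := w_gt0 x; have wy := w_gt0 y.
rewrite -subr_ge0.
have -> : (h y - h x) ^+ 2 - (w y - w x) * (h y ^+ 2 / w y - h x ^+ 2 / w x)
    = (w x * h y - w y * h x) ^+ 2 / (w x * w y).
  by field; rewrite !gt_eqF.
by rewrite divr_ge0 ?sqr_ge0// ltW// mulr_gt0.
Qed.

(** Extension by zero off the edges makes the weight symmetric and nonnegative on all pairs, so that
    double sums can be exchanged freely. *)
Definition conductance (R : realType) (V : finType) (G : weighted_graph R V)
    (x y : V) : R :=
  if adj G x y then weight G x y else 0.

Lemma conductance_sym (R : realType) (V : finType) (G : weighted_graph R V) x y :
  conductance G x y = conductance G y x.
Proof.
by rewrite /conductance (adj_sym G y x); case: ifP => // xy; exact: weight_sym.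
Qed.

Lemma conductance_ge0 (R : realType) (V : finType) (G : weighted_graph R V) x y :
  0 <= conductance G x y.
Proof. by rewrite /conductance; case: ifP => // xy; exact/ltW/weight_gt0. Qed.

Lemma laplacianE (R : realType) (V : finType) (G : weighted_graph R V) u x :
  vmeas G x * laplacian G u x = \sum_y conductance G x y * (u y - u x).
Proof.
rewrite /laplacian mulrA divff ?gt_eqF ?vmeas_gt0// mul1r big_mkcond.
apply: eq_bigr => y _; rewrite /conductance; case: ifP => [xy|_]; last by rewrite mul0r.
by rewrite -weight_sym.
Qed.

Lemma vint_grad_sq (R : realType) (V : finType) (G : weighted_graph R V) v :
  vint G (grad_sq G v) =
  2^-1 * \sum_x \sum_y conductance G x y * (v y - v x) ^+ 2.
Proof.
rewrite mulr_sumr; apply: eq_bigr => x _; rewrite /grad_sq invfM mulrCA.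
rewrite -mulrA mulKf ?gt_eqF ?vmeas_gt0//; congr (_ * _).
rewrite big_mkcond; apply: eq_bigr => y _; rewrite /conductance.
by case: ifP => //; rewrite mul0r.
Qed.

Lemma laplacian_diff_quotient (R : realType) (V : finType)
    (G : weighted_graph R V) (u v : V -> R) (t : R) x :
  laplacian G (fun x => (u x - v x) / t) x =
  (laplacian G u x - laplacian G v x) / t.
Proof.
rewrite /laplacian -mulrBr -mulrA -sumrB mulr_suml; congr (_ * _).
by apply: eq_bigr => y _; ring.
Qed.

Lemma laplacian_at_min (R : realType) (V : finType) (G : weighted_graph R V)
    (w : V -> R) x :
  (forall y, w x <= w y) -> 0 <= laplacian G w x.
Proof.
move=> wx; rewrite -(pmulr_rge0 _ (vmeas_gt0 G x)) laplacianE.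
by apply: sumr_ge0 => y _; rewrite mulr_ge0 ?conductance_ge0// subr_ge0.
Qed.

(** Only the term [vmeas G x * h x ^+ 2] of the norm is kept; smallness in the norm thus becomes
    pointwise smallness. *)
Lemma W12norm_ge (R : realType) (V : finType) (G : weighted_graph R V)
    (h : V -> R) (m : R) x :
  0 <= m -> m <= vmeas G x -> Num.sqrt m * `|h x| <= W12norm G h.
Proof.
move=> m0 mx; rewrite -sqrtr_sqr -sqrtrM// ler_wsqrtr//.
have g0 y : 0 <= vmeas G y * (grad_sq G h y + h y ^+ 2).
  rewrite mulr_ge0 ?(ltW (vmeas_gt0 _ _))// addr_ge0 ?sqr_ge0// /grad_sq.
  rewrite mulr_ge0 ?invr_ge0 ?mulr_ge0 ?(ltW (vmeas_gt0 _ _))//.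
  by apply: sumr_ge0 => z yz; rewrite mulr_ge0 ?sqr_ge0// ltW// weight_gt0.
rewrite /vint (bigD1 x)//= -[leLHS]addr0 lerD ?sumr_ge0//.
apply: ler_pM => //; first exact: sqr_ge0.
rewrite lerDr mulr_ge0 ?invr_ge0 ?mulr_ge0 ?(ltW (vmeas_gt0 _ _))//.
by apply: sumr_ge0 => z yz; rewrite mulr_ge0 ?sqr_ge0// ltW// weight_gt0.
Qed.

(** Strong maximum principle. At a maximum with nonnegative value [F] vanishes, so the Laplacian
    equals the nonnegative Dirac sum while being nonpositive; hence all neighbours attain the
    maximum. By connectedness [u] is constant, which contradicts the positive mass at a vortex. *)
Lemma vortex_solution_lt0 (R : realType) (V : finType)
    (G : weighted_graph R V) (M : nat) (p : 'I_M -> V) (lambda : R)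
    (u : V -> R) :
  connected_graph G -> (0 < M)%N -> vortex_eq G p lambda u ->
  forall x, u x < 0.
Proof.
move=> hconn M0 hu x0.
pose m := [arg max_(x > x0) u x]%O.
have um y : u y <= u m by rewrite /m; case: Order.TotalTheory.arg_maxP => // i _; exact.
apply: (le_lt_trans (um x0)); rewrite ltNge; apply/negP => um0.
have dirac_ge0 j y : 0 <= vdirac G (p j) y.
  by rewrite /vdirac; case: ifP => // _; rewrite invr_ge0 ltW// vmeas_gt0.
have Fm : F (u m) = 0.
  rewrite /F; case: ifPn => // um0'.
  have -> : u m = 0 by apply/eqP; rewrite eq_le um0'.
  by apply: Ftilde_unique => //; rewrite expR0; lra.
have lapE y : u y = u m -> laplacian G u y = 4 * pi * \sum_(j < M) vdirac G (p j) y.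
  by move=> yE; rewrite hu yE Fm expR0 subrr expr0n/= mulr0 add0r.
have lap0 y : u y = u m -> \sum_z conductance G y z * (u y - u z) = 0.
  move=> yE; apply: le_anti; apply/andP; split; last first.
    by apply: sumr_ge0 => z _; rewrite mulr_ge0 ?conductance_ge0// subr_ge0 yE.
  have -> : \sum_z conductance G y z * (u y - u z) = - (vmeas G y * laplacian G u y).
    by rewrite laplacianE -sumrN; apply: eq_bigr => z _; ring.
  rewrite oppr_le0 mulr_ge0 ?(ltW (vmeas_gt0 _ _))// lapE//.
  by rewrite mulr_ge0 ?sumr_ge0// mulr_ge0// pi_ge0.
have step y z : adj G y z -> u y = u m -> u z = u m.
  move=> yz yE; have /psumr_eq0P := lap0 y yE.
  move=> /(_ _ z isT); rewrite /conductance yz => H.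
  have /eqP : weight G y z * (u y - u z) = 0.
    apply: H => t _; rewrite -[X in X * _]/(conductance G y t).
    by rewrite mulr_ge0 ?conductance_ge0// subr_ge0 yE.
  by rewrite mulf_eq0 gt_eqF ?weight_gt0//= subr_eq0 yE => /eqP.
have all_m y : u y = u m.
  have /connectP[s] := hconn m y.
  elim/last_ind: s y => [y _ ->//|s z IH y].
  rewrite rcons_path last_rcons => /andP[ps sz] ->.
  by apply: (step _ _ sz); exact: IH.
have := lapE (p (Ordinal M0)) (all_m _).
have -> : laplacian G u (p (Ordinal M0)) = 0.
  rewrite /laplacian big1 ?mulr0// => y _.
  by rewrite !all_m subrr mulr0.
move=> /esym/eqP; rewrite mulf_eq0 gt_eqF ?mulr_gt0 ?pi_gt0//=.
rewrite (bigD1 (Ordinal M0))//= gt_eqF// ltr_wpDr ?sumr_ge0//.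
by rewrite /vdirac eqxx invr_gt0 vmeas_gt0.
Qed.

(** * The functional near a solution and a criterion for strict minimality *)

(** The cross term of the gradient part is summed by parts and the equation for [u \- u0] inserted;
    its constant cancels the linear part of [J]. The remaining term in [vortex_term] is set to
    cancel the first-order variation of the potential. *)
Lemma J_increment (R : realType) (V : finType) (G : weighted_graph R V)
    (M : nat) (p : 'I_M -> V) (lambda : R) (u u0 v : V -> R) :
  vortex_eq G p lambda u -> background_eq G p u0 ->
  let h := v \- (u \- u0) in
  J G M u0 lambda v - J G M u0 lambda (u \- u0) =
  2^-1 * vint G (grad_sq G h)
  + \sum_x vmeas G x * (lambda * vortex_term (u x) * h x
      + lambda / 4 * ((expR (F (u x + h x)) - 1) ^+ 4
                      - (expR (F (u x)) - 1) ^+ 4)).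
Proof.
move=> hu hu0 h; set v0 := u \- u0; set c := 4 * pi * M%:R / volume G.
have lapv0 x : laplacian G v0 x = - lambda * vortex_term (u x) + c.
  (* A difference is a difference quotient with step 1. *)
  have -> : laplacian G v0 x = laplacian G (fun x => (u x - u0 x) / 1) x.
    by rewrite /laplacian; congr (_ * _); apply: eq_bigr => y _; rewrite /v0/= !divr1.
  rewrite laplacian_diff_quotient divr1 hu hu0 /vortex_term -/c; ring.
have grad : vint G (grad_sq G v) = vint G (grad_sq G v0) + vint G (grad_sq G h)
    - 2 * \sum_x vmeas G x * laplacian G v0 x * h x.
  have -> : \sum_x vmeas G x * laplacian G v0 x * h x =
      \sum_x (\sum_y conductance G x y * (v0 y - v0 x)) * h x.
    by apply: eq_bigr => x _; rewrite laplacianE.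
  rewrite sum_by_parts; last exact: conductance_sym.
  rewrite !vint_grad_sq.
  suff -> : \sum_x \sum_y conductance G x y * (v y - v x) ^+ 2 =
      \sum_x \sum_y conductance G x y * (v0 y - v0 x) ^+ 2
      + \sum_x \sum_y conductance G x y * (h y - h x) ^+ 2
      + 2 * \sum_x \sum_y conductance G x y * ((v0 y - v0 x) * (h y - h x)) by lra.
  rewrite mulr_sumr -!big_split; apply: eq_bigr => x _ /=.
  rewrite mulr_sumr -!big_split; apply: eq_bigr => y _ /=.
  by rewrite /h /v0 /=; ring.
rewrite /J grad -/c.
set L := \sum_x _; set P := vint G (fun x => (expR (F (u0 x + v x)) - 1) ^+ 4).
set P0 := vint G (fun x => (expR (F (u0 x + v0 x)) - 1) ^+ 4).
set Q := RHS.
suff : - L + lambda / 4 * (P - P0) + c * (vint G v - vint G v0) =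
    Q - 2^-1 * vint G (grad_sq G h) by lra.
rewrite /Q (addrC (2^-1 * _)) addrK /L /P /P0 /vint -sumrN -!sumrB !mulr_sumr -!big_split.
apply: eq_bigr => x _ /=; rewrite lapv0.
have -> : u0 x + v x = u x + h x by rewrite /h/=; ring.
have -> : u0 x + v0 x = u x by rewrite /v0/=; ring.
have -> : v x = v0 x + h x by rewrite /h/= addrC subrK.
ring.
Qed.

Lemma strict_local_min_supersolution (R : realType) (V : finType)
    (G : weighted_graph R V) (M : nat) (p : 'I_M -> V) (lambda : R)
    (u u0 w : V -> R) :
  0 < lambda -> vortex_eq G p lambda u -> background_eq G p u0 ->
  (forall x, u x < 0) -> (forall x, 0 < w x) ->
  (forall x, laplacian G w x + lambda * dvortex_term (u x) * w x < 0) ->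
  strict_local_min_W12 G (J G M u0 lambda) (u \- u0).
Proof.
move=> l0 hu hu0 u_lt0 w_gt0 super.
(* Chosen so that -(Laplacian w)/w = al + lambda f'(u), with al > 0. *)
pose al x := - (laplacian G w x + lambda * dvortex_term (u x) * w x) / w x.
have al0 x : 0 < al x by rewrite divr_gt0// oppr_gt0.
(* Picone leaves al/2 h^2 once the f' terms cancel; the tolerance al/lambda, multiplied by lambda/4,
   spends half of it. *)
have taylor x := potential_taylor2 (u_lt0 x) (divr_gt0 (al0 x) l0).
have [r r0 tr] := near0_forall taylor.
have [m m0 mG] := pos_lower_bound (vmeas_gt0 G).
exists (r * Num.sqrt m) => [|v vv0 vr]; first by rewrite mulr_gt0 ?sqrtr_gt0.
rewrite -subr_gt0 (J_increment v hu hu0) /=; set h := v \- (u \- u0).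
have hr x : `|h x| < r.
  rewrite -(ltr_pM2r (x := Num.sqrt m)) ?sqrtr_gt0// mulrC.
  by apply: le_lt_trans vr; apply: W12norm_ge => //; exact: ltW.
have [x0 hx0] : exists x, h x != 0.
  apply: contrapT => /forallNP h0; apply: vv0; apply/funext => x.
  have /negP/negbNE := h0 x; rewrite /h/= subr_eq0 => /eqP; exact.
have P : - \sum_x vmeas G x * laplacian G w x * (h x ^+ 2 / w x) <=
    vint G (grad_sq G h).
  rewrite vint_grad_sq; under eq_bigr do rewrite laplacianE.
  by apply: picone => //; [exact: conductance_sym|exact: conductance_ge0].
apply: (@lt_le_trans _ _ (\sum_x vmeas G x * (al x / 4 * h x ^+ 2))).
  have pos x : 0 <= vmeas G x * (al x / 4 * h x ^+ 2).
    apply: mulr_ge0; first exact/ltW/vmeas_gt0.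
    by rewrite mulr_ge0 ?sqr_ge0// divr_ge0// ltW.
  rewrite (bigD1 x0)//= ltr_wpDr ?sumr_ge0//.
  apply: mulr_gt0; first exact: vmeas_gt0.
  by apply: mulr_gt0; [rewrite divr_gt0|rewrite exprn_even_gt0].
apply: (@le_trans _ _ (2^-1 * (- \sum_x vmeas G x * laplacian G w x * (h x ^+ 2 / w x))
  + \sum_x vmeas G x *
     (lambda * vortex_term (u x) * h x
      + lambda / 4 * ((expR (F (u x + h x)) - 1) ^+ 4
                      - (expR (F (u x)) - 1) ^+ 4)))); last first.
  by rewrite lerD2r ler_wpM2l.
rewrite -sumrN mulr_sumr -big_split; apply: ler_sum => x _ /=.
have := tr _ (hr x) x.
set D := _ ^+ 4 - _ ^+ 4; rewrite ler_norml => /andP[+ _] => DT.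
have -> : 2^-1 * - (vmeas G x * laplacian G w x * (h x ^+ 2 / w x)) =
    vmeas G x * (2^-1 * (al x + lambda * dvortex_term (u x)) * h x ^+ 2).
  by rewrite /al; field; rewrite gt_eqF.
rewrite -mulrDr ler_wpM2l ?(ltW (vmeas_gt0 _ _))//.
have : lambda / 4 * (- (al x / lambda * h x ^+ 2)) <=
    lambda / 4 * (D - - 4 * vortex_term (u x) * h x
      - - 4 * dvortex_term (u x) / 2 * h x ^+ 2).
  by rewrite ler_wpM2l// divr_ge0// ltW.
have -> : lambda / 4 * (- (al x / lambda * h x ^+ 2)) = - (al x / 4 * h x ^+ 2).
  by field; rewrite gt_eqF.
by lra.
Unshelve. all: by end_near. Qed.

(** * Positive strict supersolutions from the family in lambda *)

Lemma gt_near_shift (R : realType) (f : R -> R) (u c : R) :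
  derivable f u 1 -> c < f u -> \forall h \near (0 : R), c < f (u + h).
Proof.
move=> /derivable1_diffP/differentiable_continuous fu cf.
have /nbhs_ballP[r /= r0 rf] : \forall x \near u, c < f x by exact: (cvgr_gt (f u) fu).
apply/nbhs_ballP; exists r => //= h hr; apply: rf; move: hr.
by rewrite /ball/= sub0r opprD addrA subrr sub0r.
Qed.

(* A difference quotient of the family in [lambda], over a step so short that
   the linearization of the equation is accurate, is a positive strict
   supersolution. *)
Lemma supersolution_diff_quotient (R : realType) (V : finType)
    (G : weighted_graph R V) (M : nat) (p : 'I_M -> V) (ut : R -> V -> R)
    (lambda_c lambda K : R) :
  0 < lambda -> lambda_c < lambda -> 0 < K ->
  (forall l, lambda_c <= l -> vortex_eq G p l (ut l)) ->
  (forall l1 l2, lambda_c <= l2 -> l2 < l1 -> forall x, ut l2 x <= ut l1 x) ->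
  (forall x, ut lambda x < 0) ->
  (forall d, 0 < d -> exists l, [/\ `|l - lambda| < d, l != lambda &
     forall x, `|ut l x - ut lambda x| <= K * `|l - lambda|]) ->
  exists2 w : V -> R, (forall x, 0 < w x) &
    forall x, laplacian G w x + lambda * dvortex_term (ut lambda x) * w x < 0.
Proof.
move=> l0 lcl K0 hsol hmono u_lt0 slope; set u := ut lambda.
(* With 0 <= w <= K, the linearization error then contributes at most f(u)/4. *)
pose e x := vortex_term (u x) / (4 * lambda * K).
have e0 x : 0 < e x by rewrite divr_gt0 ?vortex_term_gt0// !mulr_gt0.
have lin x : \forall z \near (0 : R), `|vortex_term (u x + z) - vortex_term (u x)
     - dvortex_term (u x) * z| <= e x * `|z| /\ vortex_term (u x) / 2 < vortex_term (u x + z).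
  have df := is_derive_vortex_term (u_lt0 x).
  near=> z; split; near: z; first exact: is_derive_near.
  apply: gt_near_shift; first exact: ex_derive.
  by have := vortex_term_gt0 (u_lt0 x); rewrite -/u; lra.
have [r r0 rlin] := near0_forall lin.
(* The first bound keeps |w t| below [r], the second keeps [l] above [lambda_c]. *)
have [|l [ld lNl lK]] := slope (Num.min (r / K) (lambda - lambda_c)).
  by rewrite lt_min divr_gt0//= subr_gt0.
move: ld; rewrite lt_min => /andP[lr llc].
have lcl' : lambda_c <= l.
  by move: llc; rewrite ltr_norml => /andP[+ _]; lra.
set t := l - lambda in lr llc lK.
have t0 : t != 0 by rewrite subr_eq0.
pose w x := (ut l x - u x) / t.
have wE x : ut l x = u x + w x * t by rewrite /w divfK// addrC subrK.
have w_ge0 x : 0 <= w x.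
  have [ll|ll|/eqP] := ltgtP l lambda; last by rewrite (negPf lNl).
    rewrite /w -mulrNN -invrN opprB mulr_ge0 ?subr_ge0 ?invr_ge0 ?hmono//.
    by rewrite /t opprB ltW// subr_gt0.
  by rewrite divr_ge0// ?subr_ge0 ?(ltW ll)// hmono// ltW.
have w_leK x : w x <= K.
  rewrite -(ger0_norm (w_ge0 x)) /w normrM normfV ler_pdivrMr ?normr_gt0//.
have super x : laplacian G w x + lambda * dvortex_term (u x) * w x < 0.
  have zr : `|w x * t| < r.
    rewrite normrM ger0_norm//; apply: (@le_lt_trans _ _ (K * `|t|)).
      by rewrite ler_wpM2r.
    by rewrite mulrC -ltr_pdivlMr.
  have := rlin _ zr x; rewrite -wE => -[lin1 lin2].
  rewrite laplacian_diff_quotient !hsol// ?ltW//.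
  set rho := vortex_term (ut l x) - vortex_term (u x) - dvortex_term (u x) * (w x * t) in lin1.
  (* The Dirac terms cancel and l = lambda + t. Of the two resulting terms the first is below
     -f(u)/2 and the second at most f(u)/4. *)
  have -> : (- l * expR (F (ut l x)) * (expR (F (ut l x)) - 1) ^+ 2 +
    4 * pi * \sum_(j < M) vdirac G (p j) x -
    (- lambda * expR (F (ut lambda x)) * (expR (F (ut lambda x)) - 1) ^+ 2 +
     4 * pi * \sum_(j < M) vdirac G (p j) x)) / t +
     lambda * dvortex_term (u x) * w x = - vortex_term (ut l x) - lambda * (rho / t).
    rewrite /rho /vortex_term -/u.
    have -> : l = t + lambda by rewrite /t subrK.
    by field.
  have : `|rho / t| <= e x * K.
    rewrite normrM normfV ler_pdivrMr ?normr_gt0// -mulrA.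
    apply: (le_trans lin1); rewrite ler_wpM2l ?(ltW (e0 x))// normrM ger0_norm//.
    by rewrite ler_wpM2r.
  rewrite ler_norml => /andP[rt _].
  have : lambda * (- (e x * K)) <= lambda * (rho / t) by rewrite ler_wpM2l// ltW.
  have -> : lambda * (- (e x * K)) = - vortex_term (u x) / 4.
    by rewrite /e; field; rewrite !gt_eqF.
  by have := vortex_term_gt0 (u_lt0 x); rewrite -/u; lra.
(* A zero of [w] would be a minimum, where the Laplacian is nonnegative, against [super]. *)
exists w => // x; rewrite lt_neqAle w_ge0 andbT eq_sym; apply/eqP => wx0.
have := super x; rewrite wx0 mulr0 addr0 ltNge laplacian_at_min// => y.
by rewrite wx0.
Unshelve. all: by end_near. Qed.

(** * Strict local minimality for almost every lambda *)

Theorem theorem2p2 (R : realType) (V : finType) (G : weighted_graph R V)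
    (hconn : connected_graph G)
    (M : nat) (hM : (1 <= M)%N) (p : 'I_M -> V) (hp : injective p)
    (lambda_c : R) (hc : critical_value G p lambda_c)
    (ut : R -> V -> R)
    (hsol : forall lambda : R, lambda_c <= lambda ->
      vortex_eq G p lambda (ut lambda))
    (hmono : forall lambda1 lambda2 : R,
      lambda_c <= lambda2 -> lambda2 < lambda1 ->
      forall x : V, ut lambda2 x <= ut lambda1 x)
    (u0 : V -> R) (hu0 : background_eq G p u0) :
  {ae @lebesgue_measure R, forall lambda : R, lambda_c < lambda ->
    strict_local_min_W12 G (J G M u0 lambda) (ut lambda \- u0)}.
Proof.
have [lc0 _] := hc.
(* Clamping at [lambda_c] extends the family monotonically to all real parameters. *)
pose c (l : R) := Num.max lambda_c l.
have c_ge l : lambda_c <= c l by rewrite le_max lexx.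
have ut_mono x : {homo ut^~ x \o c : l1 l2 / l1 <= l2}.
  move=> l1 l2 l12 /=; have : c l1 <= c l2 by rewrite le_max2 // lexx.
  by rewrite le_eqVlt => /predU1P[->//|?]; exact: hmono.
pose S l := \sum_x ut (c l) x.
have ndS : {homo S : l1 l2 / l1 <= l2}.
  by move=> l1 l2 l12; apply: ler_sum => x _; exact: ut_mono.
(* All summands of [S] vary in the same direction, so [S] controls each vertex at once and one
   exceptional null set suffices. *)
have utS l1 l2 x : `|ut (c l1) x - ut (c l2) x| <= `|S l1 - S l2|.
  wlog l12 : l1 l2 / l2 <= l1.
    move=> H; have [|/ltW] := leP l2 l1; first exact: H.
    by move=> l12; rewrite distrC [leRHS]distrC; exact: H.
  rewrite !ger0_norm ?subr_ge0 ?ndS//; last exact: ut_mono.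
  rewrite -sumrB (bigD1 x)//= lerDl sumr_ge0// => y _.
  by rewrite subr_ge0; exact: ut_mono.
apply: negligibleS (ae_bounded_slope ndS) => lambda /= + slopes; apply.
move: slopes => [K slope] lcl.
have l0 := lt_trans lc0 lcl.
have hu := hsol _ (ltW lcl).
have u_lt0 := vortex_solution_lt0 hconn hM hu.
have cl : c lambda = lambda by apply/max_idPr; exact: ltW.
(* [|K| + 1] turns the slope bound, of unknown sign, into a positive one. *)
have [|d d0|w w0 hw] :=
    supersolution_diff_quotient (K := `|K| + 1) l0 lcl _ hsol hmono u_lt0.
- by rewrite ltr_wpDl.
(* The distance to [lambda_c] keeps [l] where the clamp is inactive. *)
- have [|l [ld lNl Sl]] := slope (Num.min d (lambda - lambda_c)).
    by rewrite lt_min d0 subr_gt0.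
  move: ld; rewrite lt_min => /andP[ld llc]; exists l; split=> // x.
  have cl' : c l = l.
    by apply/max_idPr; move: llc; rewrite ltr_norml => /andP[+ _]; lra.
  have := utS l lambda x; rewrite cl cl' => /le_trans; apply.
  apply: (le_trans Sl); rewrite ler_wpM2r//.
  by rewrite (le_trans (ler_norm K))// lerDl.
exact: strict_local_min_supersolution hw.
Qed.
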